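(* Let $H$ be a complex Hilbert space and let $T:H\to H$ be a bounded linear operator. If $\lambda\in\mathbb{C}\setminus\{0\}$ and $r>0$ are such that $$\|T-\lambda I\|\le r,$$ then $$0\le \|T\|-w(T)\le \frac12\cdot\frac{r^2}{|\lambda|}.$$
   Context: $I$ denotes the identity operator on $H$ and $\|\cdot\|$ the operator norm. The numerical radius of a bounded linear operator $T$ on $H$ is $w(T)=\sup\{|\langle Tx,x\rangle| : x\in H,\ \|x\|=1\}$. *)

(* Defs.v *)
From HB Require Import structures.
From mathcomp Require Import all_boot all_order all_algebra.
From mathcomp Require Import complex.
From mathcomp Require Import all_classical all_reals all_analysis.

Set Implicit Arguments.
Unset Strict Implicit.
Unset Printing Implicit Defensive.

Import Order.TTheory GRing.Theory Num.Theory.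
Import numFieldNormedType.Exports.

Local Open Scope classical_set_scope.
Local Open Scope ring_scope.
Local Open Scope complex_scope.

(* The inner product is linear in its first argument and conjugate-linear in
   its second one. *)
HB.mixin Record CompleteNormedModule_isHilbert (R : realType) (H : Type)
    of CompleteNormedModule R[i] H := {
  inner : {dot H for @Num.conj R[i]};
  sqr_norm_inner : forall x : H, `|x| ^+ 2 = inner x x
}.

#[short(type="hilbertType")]
HB.structure Definition Hilbert (R : realType) :=
  {H of CompleteNormedModule_isHilbert R H & CompleteNormedModule R[i] H}.

(* Norms over [R[i]] take their values in [R[i]], more precisely among its
   nonnegative reals; [rnorm x] is the same number as an element of [R]. *)
Definition rnorm (R : realType) (V : normedZmodType R[i]) (x : V) : R :=
  complex.Re `|x|.

Definition bounded_operator (R : realType) (H : hilbertType R) (T : H -> H) :=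
  exists M : R, forall x : H, rnorm (T x) <= M * rnorm x.

(* [sup] is 0 on the empty set and on sets without an upper bound, so [opnorm]
   is the operator norm for bounded operators only. *)
Definition opnorm (R : realType) (H : hilbertType R) (T : H -> H) : R :=
  sup [set rnorm (T x) | x in [set x : H | rnorm x <= 1]].

(* On the zero space there is no unit vector, and the value is [sup set0 = 0]. *)
Definition numerical_radius (R : realType) (H : hilbertType R) (T : H -> H)
    : R :=
  sup [set rnorm (inner (T x) x) | x in [set x : H | rnorm x = 1]].

(* Main.v *)
(* For a unit vector x, expanding the square in ||Tx - lambda x|| <= r and
   using <Tx, lambda x> = conj(lambda) <Tx, x> gives
   ||Tx||^2 + |lambda|^2 <= r^2 + 2 |lambda| w(T), while AM-GM bounds the left
   side below by 2 |lambda| ||Tx||; divide by 2 |lambda| and take the supremum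
   over x. *)
Require Import Defs.
From HB Require Import structures.
From mathcomp Require Import all_boot all_order all_algebra.
From mathcomp Require Import complex ring lra.
From mathcomp Require Import all_classical all_reals all_analysis.

Set Implicit Arguments.
Unset Strict Implicit.

Import Order.TTheory GRing.Theory Num.Theory.
Import numFieldNormedType.Exports.

Local Open Scope ring_scope.
Local Open Scope complex_scope.

Section RealNorm.
Context {R : realType}.

Lemma rnormE (V : normedZmodType R[i]) (x : V) : (rnorm x)%:C = `|x|.
Proof. by rewrite /rnorm RRe_real// normr_real. Qed.

Lemma rnorm_ge0 (V : normedZmodType R[i]) (x : V) : 0 <= rnorm x.
Proof. by rewrite -ler0c rnormE. Qed.

Lemma rnorm0 (V : normedZmodType R[i]) : rnorm (0 : V) = 0.
Proof. by rewrite /rnorm normr0. Qed.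

Lemma rnorm_eq0 (V : normedZmodType R[i]) (x : V) : (rnorm x == 0) = (x == 0).
Proof. by rewrite -(inj_eq (@complexI R)) rnormE normr_eq0. Qed.

Lemma rnorm_gt0 (V : normedZmodType R[i]) (x : V) : (0 < rnorm x) = (x != 0).
Proof. by rewrite lt_def rnorm_eq0 rnorm_ge0 andbT. Qed.

Lemma ler_rnormB (V : normedZmodType R[i]) (x y : V) :
  rnorm (x - y) <= rnorm x + rnorm y.
Proof. by rewrite -lecR rmorphD/= !rnormE ler_normB. Qed.

Lemma rnormZ (V : normedModType R[i]) (a : R[i]) (x : V) :
  rnorm (a *: x) = rnorm a * rnorm x.
Proof. by apply: (@complexI R); rewrite rmorphM/= !rnormE normrZ. Qed.

Lemma rnormM (a b : R[i]) : rnorm (a * b) = rnorm a * rnorm b.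
Proof. by apply: (@complexI R); rewrite rmorphM/= !rnormE normrM. Qed.

Lemma rnorm_conjC (a : R[i]) : rnorm a^* = rnorm a.
Proof. by rewrite /rnorm normcJ. Qed.

Lemma rnorm_real (a : R) : 0 <= a -> rnorm (a%:C : R[i]) = a.
Proof.
by move=> a0; apply: (@complexI R); rewrite rnormE ger0_norm// ler0c.
Qed.

End RealNorm.

(** If [A] has no supremum, [sup A] is the default value 0; otherwise any element of [A] lies
    between 0 and [sup A]. *)
Lemma sup_ge0 (R : realType) (A : set R) :
  (forall x, A x -> 0 <= x) -> 0 <= sup A.
Proof.
move=> A_ge0; have [[[x Ax] ubA]|/sup_out->//] := pselect (has_sup A).
exact: le_trans (A_ge0 _ Ax) (ub_le_sup ubA Ax).
Qed.

Section InnerProduct.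
Context {R : realType} {H : hilbertType R}.
Implicit Types (x y : H) (T : {linear H -> H}).

Lemma sqr_rnorm_inner x : (rnorm x ^+ 2)%:C = inner x x.
Proof. by rewrite rmorphXn/= rnormE sqr_norm_inner. Qed.

Lemma rnorm_innerZr (a : R[i]) x y :
  rnorm (inner x (a *: y)) = rnorm a * rnorm (inner x y).
Proof. by rewrite linearZr/= rnormM rnorm_conjC. Qed.

(** The cross term in the expansion of the square is twice the real part of [inner x y], which is at
    most twice its modulus. *)
Lemma sqr_rnormB_ge x y :
  rnorm x ^+ 2 + rnorm y ^+ 2 - 2 * rnorm (inner x y) <= rnorm (x - y) ^+ 2.
Proof.
rewrite -lecR sqr_rnorm_inner dnormB mulr_natl rmorphB rmorphD rmorphMn /=.
rewrite !sqr_rnorm_inner rnormE lerD2l lerN2.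
rewrite (_ : _ + _^* = 2 * (complex.Re (inner x y))%:C); last exact: addcJ.
rewrite -[leRHS]mulr_natl ler_pM2l ?ltr0n//; apply: le_trans (normc_ge_Re _).
by rewrite lecR ler_norm.
Qed.

(* The library's [CauchySchwarz] is restricted to finite-dimensional spaces. *)
Lemma inner_CauchySchwarz x y : rnorm (inner x y) <= rnorm x * rnorm y.
Proof.
have [->|y0] := eqVneq y 0; first by rewrite linear0r /= !rnorm0 mulr0.
set d := inner x y.
(* This vector is [|y| ^+ 2] times the component of [x] orthogonal to [y], scaled so as to avoid
   division. *)
have : 0 <= inner (`|y| ^+ 2 *: x - d *: y) (`|y| ^+ 2 *: x - d *: y).
  by rewrite -sqr_norm_inner exprn_ge0.
rewrite dnormB !dnormZ linearZlr /= -/d -!sqr_norm_inner normrX normr_id.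
rewrite [_^* * d]mulrC -normCK geC0_conj ?mulr_ge0 ?exprn_ge0//.
rewrite (_ : _ - _ = `|y| ^+ 2 * ((`|x| * `|y|) ^+ 2 - `|d| ^+ 2)); last by ring.
rewrite pmulr_rge0 ?exprn_gt0 ?normr_gt0// subr_ge0 ler_sqr ?nnegrE ?mulr_ge0//.
by rewrite -!rnormE -rmorphM/= lecR.
Qed.

Lemma le_opnorm (S : H -> H) x :
  bounded_operator S -> rnorm x <= 1 -> rnorm (S x) <= opnorm S.
Proof.
move=> [M SM] x1; apply: ub_le_sup; last by exists x.
(* [M] can be negative when [H] is the zero space, and then [M * rnorm y <= M] fails at 0. *)
exists (Num.max 0 M) => _ [y /= y1 <-]; apply: le_trans (SM y) _.
rewrite (@le_trans _ _ (Num.max 0 M * rnorm y))//.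
  by rewrite ler_wpM2r ?rnorm_ge0 // le_max lexx orbT.
by rewrite ler_piMr // le_max lexx.
Qed.

Lemma opnorm_ge0 (S : H -> H) : 0 <= opnorm S.
Proof. by apply: sup_ge0 => _ [x _ <-]; exact: rnorm_ge0. Qed.

(** By homogeneity the unit sphere controls the nonzero vectors of the ball; [0 <= M] covers the
    vector 0, hence also the zero space. *)
Lemma opnorm_le T (M : R) : 0 <= M ->
  (forall x, rnorm x = 1 -> rnorm (T x) <= M) -> opnorm T <= M.
Proof.
move=> M0 TM; apply: ge_sup => [|_ [x /= x1 <-]].
  by exists (rnorm (T 0)); exists 0; rewrite //= rnorm0.
have [->|x0] := eqVneq x 0; first by rewrite linear0 rnorm0.
have x_gt0 : 0 < rnorm x by rewrite rnorm_gt0.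
have := TM ((rnorm x)^-1%:C *: x).
rewrite linearZ/= !rnormZ rnorm_real ?invr_ge0 ?rnorm_ge0//.
rewrite mulVf ?gt_eqF// => /(_ erefl).
rewrite mulrC ler_pdivrMr// => /le_trans.
by apply; rewrite ler_piMr.
Qed.

Lemma numerical_radius_ge0 (S : H -> H) : 0 <= numerical_radius S.
Proof. by apply: sup_ge0 => _ [x _ <-]; exact: rnorm_ge0. Qed.

Lemma rnorm_inner_le_opnorm (S : H -> H) x :
  bounded_operator S -> rnorm x = 1 -> rnorm (inner (S x) x) <= opnorm S.
Proof.
move=> S_bounded x1; apply: le_trans (inner_CauchySchwarz _ _) _.
by rewrite x1 mulr1 le_opnorm ?x1.
Qed.

Lemma le_numerical_radius (S : H -> H) x : bounded_operator S ->
  rnorm x = 1 -> rnorm (inner (S x) x) <= numerical_radius S.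
Proof.
move=> S_bounded x1; apply: ub_le_sup; last by exists x.
(* An upper bound is required for [sup] to dominate the elements; Cauchy-Schwarz supplies
   [opnorm S]. *)
by exists (opnorm S) => _ [y /= y1 <-]; apply: rnorm_inner_le_opnorm.
Qed.

Lemma numerical_radius_le_opnorm (S : H -> H) :
  bounded_operator S -> numerical_radius S <= opnorm S.
Proof.
move=> S_bounded; rewrite /numerical_radius; set A := (X in sup X).
have [->|/set0P A0] := eqVneq A set0; first by rewrite sup0 opnorm_ge0.
by apply: ge_sup => // _ [x /= x1 <-]; apply: rnorm_inner_le_opnorm.
Qed.

End InnerProduct.

Theorem theorem8 (R : realType) (H : hilbertType R) (T : {linear H -> H})
    (T_bounded : bounded_operator T) (lambda : R[i]) (r : R)
    (lambda_neq0 : lambda != 0) (r_gt0 : 0 < r)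
    (T_near : opnorm (T \- lambda \*: idfun) <= r) :
  0 <= opnorm T - numerical_radius T
    <= 1 / 2 * (r ^+ 2 / rnorm lambda).
Proof.
have l_gt0 : 0 < rnorm lambda by rewrite rnorm_gt0.
(* This makes [opnorm] of the difference a genuine supremum, so that [T_near] yields a bound at each
   unit vector. *)
have S_bounded : bounded_operator (T \- lambda \*: idfun).
  have [M TM] := T_bounded; exists (M + rnorm lambda) => x /=.
  by rewrite mulrDl (le_trans (ler_rnormB _ _))// rnormZ lerD2r.
rewrite subr_ge0 numerical_radius_le_opnorm//= lerBlDl.
apply: opnorm_le => [|x x1].
  rewrite addr_ge0 ?numerical_radius_ge0// mulr_ge0//.
  by rewrite divr_ge0 ?sqr_ge0 ?ltW.
have Sx : rnorm (T x - lambda *: x) <= r.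
  by apply: le_trans T_near; apply: (le_opnorm S_bounded); rewrite x1.
have := sqr_rnormB_ge (T x) (lambda *: x).
rewrite rnorm_innerZr rnormZ x1 mulr1.
have := le_numerical_radius T_bounded x1.
have := rnorm_ge0 (T x - lambda *: x).
move: Sx l_gt0.
set t := rnorm (T x); set l := rnorm lambda.
set d := rnorm (inner _ _); set w := numerical_radius T; set s := rnorm (_ - _).
move=> sr l0 s0 dw ineq.
have ldw : l * d <= l * w by rewrite ler_pM2l.
have sr2 : s ^+ 2 <= r ^+ 2 by rewrite ler_sqr ?nnegrE// ltW.
(* Multiplying by [l] leaves [t * l <= w * l + 1 / 2 * r ^+ 2], which is half of the chain [2tl <=
   t^2 + l^2 <= s^2 + 2ld <= r^2 + 2lw]. *)
rewrite -(ler_pM2r l0) mulrDl -(mulrA (1 / 2)) divfK ?gt_eqF//.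
have := sqr_ge0 (t - l).
nra.
Qed.
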